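(* Let $E$ be a finite nonempty set and $u:2^E\to\mathbb{R}$ an ordinally concave function satisfying the unique-maximizer condition: for every $X\subseteq E$, $\max\{u(Y)\mid Y\subseteq X\}$ has a unique maximizer, denoted $C(X)$. Then the choice function $C:2^E\to 2^E$ satisfies $C(X\cup Y)=C(C(X)\cup(Y\setminus X))$ for all $X,Y\in 2^E$.
   Context: Notation: for $X\subseteq E$ and $x\in E\setminus X$, $X+x=X\cup\{x\}$; for $x\in X$, $X-x=X\setminus\{x\}$. The symbol $\emptyset$ is also used as a formal element not in $E$, with $X+\emptyset=X-\emptyset=X$. A function $u:2^E\to\mathbb{R}$ is ordinally concave if for every $X,X'\in 2^E$ and every $x\in X\setminus X'$ there exists $x'\in(X'\setminus X)\cup\{\emptyset\}$ such that (i) $u(X)<u(X-x+x')$, or (ii) $u(X')<u(X'-x'+x)$, or (iii) $u(X)=u(X-x+x')$ and $u(X')=u(X'-x'+x)$. *)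

(* Defs.v *)
From mathcomp Require Import all_boot all_order all_algebra.
From mathcomp Require Import reals.

Set Implicit Arguments.
Unset Strict Implicit.
Unset Printing Implicit Defensive.

Import Order.TTheory GRing.Theory Num.Theory.
Local Open Scope ring_scope.

(* An element of E together with the formal element "emptyset" outside E is
   an [option E]; [None] is the formal element, and adding or removing it
   changes nothing. *)
Definition addo (E : finType) (X : {set E}) (o : option E) : {set E} :=
  if o is Some x then x |: X else X.

Definition delo (E : finType) (X : {set E}) (o : option E) : {set E} :=
  if o is Some x then X :\ x else X.

Definition in_or_none (E : finType) (X : {set E}) (o : option E) : bool :=
  if o is Some x then x \in X else true.

Definition ordinally_concave (R : realType) (E : finType)
    (u : {set E} -> R) : Prop :=
  forall (X X' : {set E}) (x : E), x \in X :\: X' ->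
  exists2 x' : option E, in_or_none (X' :\: X) x' &
    [\/ u X < u (addo (X :\ x) x'),
        u X' < u (x |: delo X' x')
      | u X = u (addo (X :\ x) x') /\ u X' = u (x |: delo X' x')].

Definition is_maximizer (R : realType) (E : finType) (u : {set E} -> R)
    (X Y : {set E}) : Prop :=
  Y \subset X /\ (forall Z : {set E}, Z \subset X -> u Z <= u Y).

Definition unique_maximizer (R : realType) (E : finType)
    (u : {set E} -> R) : Prop :=
  forall X : {set E}, exists! Y : {set E}, is_maximizer u X Y.

(* Main.v *)
Require Import Defs.
From mathcomp Require Import all_boot all_order all_algebra.
From mathcomp Require Import reals.

Set Implicit Arguments.
Unset Strict Implicit.
Unset Printing Implicit Defensive.

Import Order.TTheory.

Lemma maximizer_unique (R : realType) (E : finType) (u : {set E} -> R)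
    (X Y Z : {set E}) :
  unique_maximizer u -> is_maximizer u X Y -> is_maximizer u X Z -> Y = Z.
Proof.
by move=> /(_ X) [W [_ uniqW]] /uniqW <- /uniqW <-.
Qed.

(** Competitors inside [S] already compete inside [X], so discarding unchosen elements leaves the
    choice optimal. *)
Lemma maximizer_subset (R : realType) (E : finType) (u : {set E} -> R)
    (X Y S : {set E}) :
  S \subset X -> Y \subset S -> is_maximizer u X Y -> is_maximizer u S Y.
Proof.
move=> SX YS [_ maxY]; split=> // Z ZS.
exact: maxY (subset_trans ZS SX).
Qed.

(* Ordinal concavity is applied to the two maximizers themselves: the exchange
   stays inside B on one side and inside A on the other, so neither strict
   alternative can occur, and the equality one contradicts uniqueness on B. *)
Lemma maximizer_substitutable (R : realType) (E : finType)
    (u : {set E} -> R) (A B W Z : {set E}) :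
  ordinally_concave u -> unique_maximizer u -> A \subset B ->
  is_maximizer u A W -> is_maximizer u B Z -> Z :&: A \subset W.
Proof.
move=> conc uniq AB [WA maxW] [ZB maxZ].
apply/subsetP=> x /setIP[xZ xA]; apply/negPn/negP=> xNW.
have [|o o_in] := conc Z W x; first by rewrite inE xNW.
have ZoB : addo (Z :\ x) o \subset B.
  have ZxB := subset_trans (subsetDl Z [set x]) ZB.
  case: o o_in => [y|] //= /setDP[yW _].
  by rewrite subUset sub1set ZxB (subsetP AB) ?(subsetP WA).
have WoA : x |: delo W o \subset A.
  rewrite subUset sub1set xA /=.
  by case: o {o_in ZoB} => [y|] //=; apply: subset_trans (subsetDl _ _) WA.
case=> [|| [eqZ _]].
- by rewrite ltNge maxZ.
- by rewrite ltNge maxW.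
have max_o : is_maximizer u B (addo (Z :\ x) o) by split; rewrite -?eqZ.
have eqZo := maximizer_unique uniq (conj ZB maxZ) max_o.
(* The exchange has deleted [x] from [Z], and it cannot put [x] back: an added [y] lies in [W],
   while [x] does not. *)
move: xZ; rewrite eqZo; case: o o_in {ZoB WoA eqZ max_o eqZo} => [y|] /=.
  by case/setDP=> yW _; rewrite !inE eqxx orbF => /eqP xy; rewrite xy yW in xNW.
by rewrite !inE eqxx.
Qed.

Theorem theorem3p5 (R : realType) (E : finType) (E_nonempty : (0 < #|E|)%N)
    (u : {set E} -> R) (u_concave : ordinally_concave u)
    (u_unique : unique_maximizer u)
    (C : {set E} -> {set E})
    (C_max : forall X : {set E}, is_maximizer u X (C X)) :
  forall X Y : {set E}, C (X :|: Y) = C (C X :|: (Y :\: X)).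
Proof.
(* By uniqueness it suffices that [C (X :|: Y)] is also a maximizer over the smaller set, which
   reduces to its being contained in that set. *)
move=> X Y; apply: (maximizer_unique u_unique _ (C_max _)).
apply: maximizer_subset (C_max (X :|: Y)).
  by rewrite setUSS ?subsetDl //; case: (C_max X).
apply/subsetP=> e eC.
(* Elements chosen from [X :|: Y] that lie in [X] are already chosen from [X]; the others fall in
   [Y :\: X]. *)
have /subsetP sub := maximizer_substitutable u_concave u_unique
  (subsetUl X Y) (C_max X) (C_max (X :|: Y)).
have [/subsetP/(_ e eC) eXY _] := C_max (X :|: Y).
move: eXY; rewrite !inE; case: (boolP (e \in X)) => [eX _ | _ /= ->].
  by rewrite sub // inE eC.
by rewrite orbT.
Qed.
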